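(* Let $m>1$, $D>0$ and $r\ge 0$, and let $b,d$ satisfy the standing assumptions below. Then there exists a constant $\dot c=\dot c(m,r,b,d)>0$, depending on $m$, $r$ and the structure of $b(\cdot),d(\cdot)$, such that for every $c\in(0,\dot c)$ the wave profile equation $$c\phi'(t)=D(\phi^m)''(t)-d(\phi(t))+b(\phi(t-cr)),\qquad t\in\mathbb R,$$ admits no wave solution (neither semi-wavefront nor wavefront, neither sharp nor smooth). Moreover, $$\dot c(m,r,b,d)=\frac{\mu_0(m,b(\cdot),d(\cdot))+o(1)}{r},\qquad r\to+\infty,$$ for some constant $\mu_0(m,b(\cdot),d(\cdot))>0$ not depending on $r$.
   Context: Standing assumptions: the death rate $d\in C^2([0,+\infty))$ satisfies $d(0)=0$, $d'(s)>0$ and $d''(s)\ge0$ for $s>0$. The birth rate $b\in C^1([0,+\infty);[0,+\infty))$ has exactly one positive local extremum point $s_M$, which is its global maximum point; $b(0)=0$; there is $\kappa>0$ with $b(\kappa)=d(\kappa)$; $b'(0)>d'(0)$; $b'(\kappa)<d'(\kappa)$; and $d(s)<b(s)\le b'(0)s$ for $s\in(0,\kappa)$. Moreover $s_M<\kappa$. Definitions: a function $0\le\phi\in W^{1,1}_{\rm loc}(\mathbb R)\cap L^\infty(\mathbb R)$ with $\phi^m\in W^{1,1}_{\rm loc}(\mathbb R)$ is a semi-wavefront (of speed $c>0$) if (i) it satisfies the wave profile equation in the sense of distributions; (ii) $\phi(-\infty)=0$ and $0<\liminf_{t\to+\infty}\phi(t)\le\limsup_{t\to+\infty}\phi(t)<+\infty$;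 (iii) there is a maximal interval $(-\infty,t_0)$, $t_0\in(-\infty,+\infty]$, on which $\phi$ is monotonically increasing, and if $t_0<+\infty$ then $\phi(t_0)>\kappa$. A wavefront is a semi-wavefront with $\phi(+\infty)=\kappa$. A wave solution means a semi-wavefront or wavefront. It is sharp if there is $t_*\in\mathbb R$ with $\phi(t)=0$ for $t\le t_*$ and $\phi(t)>0$ for $t>t_*$, and smooth if $\phi(t)>0$ for all $t$.
   Formalization: The constants ċ and μ0 are allowed to depend on D as well as on m, b, d (and r for ċ); independence of D is impossible, since rescaling t by √D turns a wave of speed c for D=1 into one of speed √D·c. *)

(* Defs.v *)
From HB Require Import structures.
From mathcomp Require Import all_boot all_order all_algebra.
From mathcomp Require Import all_classical all_reals all_analysis.
Set Implicit Arguments. Unset Strict Implicit. Unset Printing Implicit Defensive.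
Import Order.TTheory GRing.Theory Num.Theory.
Import numFieldNormedType.Exports.
Local Open Scope classical_set_scope.
Local Open Scope ring_scope.

Section Defs.
Variable R : realType.
Local Notation mu := (@lebesgue_measure R).

Definition C1_nonneg (f f1 : R -> R) : Prop :=
  {within `[0, +oo[, continuous f} /\
  {within `[0, +oo[, continuous f1} /\
  (forall x : R, 0 < x -> is_derive x (1:R) f (f1 x)) /\
  ((fun h : R => h^-1 * (f h - f 0)) @ (0:R)^'+ --> f1 0).

Definition C2_nonneg (f f1 f2 : R -> R) : Prop :=
  C1_nonneg f f1 /\ C1_nonneg f1 f2.

Definition local_extremum (b : R -> R) (s : R) : Prop :=
  exists2 e : R, 0 < e &
    ((forall x, 0 <= x -> `|x - s| < e -> b x <= b s) \/
     (forall x, 0 <= x -> `|x - s| < e -> b s <= b x)).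

Definition standing_assumptions (b b1 d d1 d2 : R -> R) (kappa sM : R) : Prop :=
  [/\ C2_nonneg d d1 d2, d 0 = 0,
      (forall s, 0 < s -> 0 < d1 s) & (forall s, 0 < s -> 0 <= d2 s)] /\
  [/\ C1_nonneg b b1, (forall s, 0 <= s -> 0 <= b s) & b 0 = 0 ] /\
  [/\ 0 < sM, local_extremum b sM,
      (forall s, 0 < s -> local_extremum b s -> s = sM),
      (forall s, 0 <= s -> b s <= b sM) & sM < kappa ] /\
  [/\ 0 < kappa, b kappa = d kappa, d1 0 < b1 0, b1 kappa < d1 kappa &
      (forall s, 0 < s < kappa -> d s < b s /\ b s <= b1 0 * s) ].

Definition loc_integrable (g : R -> R) : Prop :=
  forall a b : R, mu.-integrable `[a, b] (EFin \o g).

(* W^{1,1}_loc(R), identified with its (locally absolutely continuous)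
   continuous representative: f is a primitive of an L^1_loc function. *)
Definition W11loc (f : R -> R) : Prop :=
  exists2 g : R -> R, loc_integrable g &
    forall x y : R, x <= y -> f y - f x = \int[mu]_(t in `[x, y]) g t.

Definition test_function (psi : R -> R) : Prop :=
  (forall (n : nat) (x : R), derivable (derive1n n psi) x 1) /\
  (exists a b : R, forall t, (t < a \/ b < t) -> psi t = 0).

(* Integrand of the weak form of
     c phi' = D (phi^m)'' - d(phi) + b(phi(t - c r))
   tested against psi (after integrating by parts). *)
Definition weak_integrand (m D c r : R) (b d phi psi : R -> R) (t : R) : R :=
  c * phi t * derive1 psi t + D * (phi t `^ m) * derive1n 2 psi t
  - d (phi t) * psi t + b (phi (t - c * r)) * psi t.

Definition distributional_solution (m D c r : R) (b d phi : R -> R) : Prop :=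
  forall psi, test_function psi ->
    mu.-integrable setT (EFin \o weak_integrand m D c r b d phi psi) /\
    \int[mu]_t weak_integrand m D c r b d phi psi t = 0.

Definition nondecr_before (phi : R -> R) (t0 : \bar R) : Prop :=
  forall x y : R, x <= y -> (y%:E < t0)%E -> phi x <= phi y.

Definition semi_wavefront (m D c r kappa : R) (b d phi : R -> R) : Prop :=
  [/\ (forall t, 0 <= phi t),
      W11loc phi, (exists M : R, forall t, `|phi t| <= M),
      W11loc (fun t => phi t `^ m) &
      distributional_solution m D c r b d phi ] /\
  [/\ phi x @[x --> -oo] --> 0,
      (exists2 e : R, 0 < e & \forall t \near +oo, e <= phi t) &
      (exists M : R, \forall t \near +oo, phi t <= M) ] /\
  (exists t0 : \bar R,
      [/\ t0 != -oo%E, nondecr_before phi t0,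
          (forall t1 : \bar R, (t0 < t1)%E -> ~ nondecr_before phi t1) &
          (forall t0r : R, t0 = t0r%:E -> kappa < phi t0r) ]).

Definition wavefront (m D c r kappa : R) (b d phi : R -> R) : Prop :=
  semi_wavefront m D c r kappa b d phi /\ phi x @[x --> +oo] --> kappa.

Definition wave_solution (m D c r kappa : R) (b d phi : R -> R) : Prop :=
  semi_wavefront m D c r kappa b d phi \/ wavefront m D c r kappa b d phi.

Definition sharp (phi : R -> R) : Prop :=
  exists ts : R, (forall t, t <= ts -> phi t = 0) /\ (forall t, ts < t -> 0 < phi t).

Definition smooth_wave (phi : R -> R) : Prop := forall t, 0 < phi t.

End Defs.

(* Main.v *)
Require Import Defs.
From HB Require Import structures.
From mathcomp Require Import all_boot all_order all_algebra.
From mathcomp Require Import all_classical all_reals all_analysis.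
From mathcomp Require Import ring lra.
Set Implicit Arguments. Unset Strict Implicit. Unset Printing Implicit Defensive.
Import Order.TTheory GRing.Theory Num.Theory.
Import numFieldNormedType.Exports.
Local Open Scope classical_set_scope.
Local Open Scope ring_scope.

(** Integrating the profile equation from [-oo] and moving the delay onto the
    birth term gives
      [D (phi^m)'(t) = c phi(t) + int_(t-cr)^t d(phi) - int_(-oo)^(t-cr) (b - d)(phi)].
    While [phi <= kappa] the last integrand is nonnegative, so [(phi^m)'] is at
    most [Gam / D] with [Gam = c kappa + c r d(kappa)].  The profile therefore
    needs a time at least of order [1 / Gam] to climb from [kappa / 4] to
    [3 kappa / 4]; during that time [b - d] is bounded below, and the last
    integral makes [(phi^m)'] negative when [c (1 + r)] is small, against
    monotonicity.  Hence [cdot r = mu0 / (1 + r)] works.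

    The distributional equation is only used through a second-difference
    identity for [D phi^m - c A - G], with [A' = phi] and
    [G''(t) = d(phi(t)) - b(phi(t - c r))], obtained by testing with the double
    antiderivative of four translates of a bump function; so [phi^m] is never
    differentiated. *)

(** * Antiderivatives on the line and their increments *)

Section Antiderivatives.
Variable R : realType.
Implicit Types (f F : R -> R) (a b x : R).

Lemma is_derive_increment_le F f a b M : a <= b ->
  (forall x, is_derive x 1 F (f x)) -> (forall x, a < x < b -> f x <= M) ->
  F b - F a <= M * (b - a).
Proof.
rewrite le_eqVlt => /predU1P[<-|ab] dF fM; first by rewrite !subrr mulr0.
have [|x xab ->] := MVT ab (f := F) (df := f) (fun x _ => dF x).
  apply: derivable_within_continuous => x _; exact: ex_derive.
by apply: ler_wpM2r; [rewrite subr_ge0 ltW|exact: fM].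
Qed.

Lemma is_derive_increment_ge F f a b M : a <= b ->
  (forall x, is_derive x 1 F (f x)) -> (forall x, a < x < b -> M <= f x) ->
  M * (b - a) <= F b - F a.
Proof.
rewrite le_eqVlt => /predU1P[<-|ab] dF fM; first by rewrite !subrr mulr0.
have [|x xab ->] := MVT ab (f := F) (df := f) (fun x _ => dF x).
  apply: derivable_within_continuous => x _; exact: ex_derive.
by apply: ler_wpM2r; [rewrite subr_ge0 ltW|exact: fM].
Qed.

Lemma is_derive0_constant F f a b : a <= b ->
  (forall x, is_derive x 1 F (f x)) -> (forall x, a < x < b -> f x = 0) ->
  F a = F b.
Proof.
move=> ab dF f0; apply/eqP; rewrite eq_le; apply/andP; split.
  rewrite -subr_ge0 -(mul0r (b - a)).
  by apply: is_derive_increment_ge dF _ => // x /f0 ->.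
rewrite -subr_le0 -(mul0r (b - a)).
by apply: is_derive_increment_le dF _ => // x /f0 ->.
Qed.

Lemma continuous_integrable_segment f a b : continuous f ->
  (@lebesgue_measure R).-integrable `[a, b] (EFin \o f).
Proof.
move=> cf; apply: continuous_compact_integrable; first exact: segment_compact.
exact: continuous_subspaceT.
Qed.

(* The primitive is glued from the integrals based at [- n]. *)
Lemma antiderivative_exists f : continuous f ->
  exists F, forall x, is_derive x 1 F (f x).
Proof.
move=> cf.
pose I (n x : R) := \int[lebesgue_measure]_(t in `[(- n), x]) f t.
have dI n x : - n < x -> is_derive x 1 (I n) (f x).
  move=> nx; have [|||dF F'] := @continuous_FTC1_closed R f (- n) x (x + 1) _ _ nx.
  - by rewrite ltrDl.
  - exact: continuous_integrable_segment.
  - exact: cf.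
  - by apply: (DeriveDef dF); rewrite -derive1E.
have IE n k x : n <= k -> - n < x -> 0 < n -> I k x - I k 0 = I n x - I n 0.
  move=> nk nx n0.
  suff: I k x - I n x = I k 0 - I n 0 by lra.
  have dD z : - n < z -> is_derive z 1 (I k - I n) 0.
    move=> nz; have -> : 0 = f z - f z by rewrite subrr.
    apply: is_deriveB; apply: dI => //; lra.
  have key u v : - n < u -> u < v -> (I k - I n) u = (I k - I n) v.
    move=> nu uv.
    have [||z zuv /eqP] := @MVT R (I k - I n) (cst 0) u v uv.
    - move=> z; rewrite in_itv/= => /andP[uz _]; apply: dD; lra.
    - apply: derivable_within_continuous => z; rewrite in_itv/= => /andP[uz _].
      have := dD z; move=> [|//]; lra.
    - by rewrite mul0r subr_eq0 => /eqP.
  have [x0|x0|->//] := ltgtP x 0; [exact: key|].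
  by symmetry; apply: key => //; lra.
(* The base [- n x] stays left of both [x] and [0]; by [IE], subtracting the value at [0] removes
   the dependence on the base. *)
pose n (x : R) : R := `|x| + 1.
exists (fun x => I (n x) x - I (n x) 0) => x.
have nx y : - n y < y by rewrite /n; have := ler_norm (- y); rewrite normrN; lra.
have n0 y : 0 < n y by rewrite /n; have := normr_ge0 y; lra.
apply: (@near_eq_is_derive _ _ _ (fun y => I (n x + 1) y - I (n x + 1) 0)).
- near=> y; apply: IE => //.
  have : `|x - y| < 1 by near: y; exact: cvgr_dist_lt.
  rewrite /n; have := ler_distD x y 0; rewrite !subr0 (distrC y); lra.
- rewrite -[f x]subr0; apply: is_deriveB; apply: dI; have := nx x; lra.
Unshelve. all: by end_near. Qed.

Lemma Rintegral_compact_support f F a b : a < b -> continuous f ->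
  (forall x, is_derive x 1 F (f x)) ->
  (forall x, x < a \/ b < x -> f x = 0) ->
  \int[lebesgue_measure]_x f x = F b - F a.
Proof.
move=> ab cf dF f0.
have -> : f = f \_ `[a, b].
  apply/funext => x; rewrite patchE; case: ifPn => // /negP xab.
  have [xa|ax] := ltP x a; first by rewrite f0//; left.
  have [bx|xb] := ltP b x; first by rewrite f0//; right.
  by exfalso; apply: xab; rewrite inE/= in_itv/= ax xb.
rewrite -Rintegral_mkcond /Rintegral (@continuous_FTC2 R f F a b ab)//.
- exact: continuous_subspaceT.
- have cF x : {for x, continuous F}.
    by apply/differentiable_continuous/derivable1_diffP.
  split => [x _||]; first exact: ex_derive.
  + exact/cvg_at_right_filter/cF.
  + exact/cvg_at_left_filter/cF.
- by move=> x _; rewrite derive1E; apply: derive_val.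
Qed.

(** Near [x], [f] is [f (x - 1)] plus an integral with variable upper limit, which is continuous
    inside [[x - 1, x + 1]]. *)
Lemma W11loc_continuous f : W11loc f -> continuous f.
Proof.
move=> [g gi fg] x.
have ab : x - 1 < x + 1 by lra.
have := @parameterized_integral_continuous R _ _ g (ltW ab) (gi _ _).
move=> /(continuous_within_itvP _ ab)[+ _ _] => /(_ x).
rewrite in_itv/= ltrBlDr ltrDl ltr01 => /(_ isT) cI.
have : {for x, continuous (fun y => f (x - 1) +
    parameterized_integral lebesgue_measure (x - 1) y g)}.
  by apply: cvgD; [exact: cvg_cst|exact: cI].
rewrite /prop_for /continuous_at {2}/parameterized_integral -fg; last lra.
rewrite [X in _ --> X]addrC subrK; apply: cvg_trans; apply: near_eq_cvg; near=> y.
rewrite /parameterized_integral -fg; first by rewrite addrC subrK.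
have : `|x - y| < 1 by near: y; exact: cvgr_dist_lt.
by rewrite ltr_norml; lra.
Unshelve. all: by end_near. Qed.

End Antiderivatives.

(** * Smooth bump functions *)

Section SmoothFunctions.
Variable R : realType.
Implicit Types (f g : R -> R) (x : R).

Definition smooth f := forall (n : nat) (x : R), derivable (derive1n n f) x 1.

(** Reduces smoothness to exhibiting a family closed under differentiation; the order of the
    derivative is the induction variable. *)
Lemma smooth_coind (P : (R -> R) -> Prop) :
  (forall f, P f -> exists2 g, P g & forall x, is_derive x 1 f (g x)) ->
  forall f, P f -> smooth f.
Proof.
move=> PS f Pf n; elim: n f Pf => [|n IH] f /PS[g Pg fg] x.
  by have := fg x; move=> [].
rewrite derive1Sn; have -> : derive1 f = g; last exact: IH.
by apply/funext => y; rewrite derive1E; have := fg y; move=> [].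
Qed.

Lemma smooth_is_derive f : smooth f -> forall x, is_derive x 1 f (derive1 f x).
Proof.
by move=> sf x; have := sf 0%N x => dfx; apply: (DeriveDef dfx); rewrite derive1E.
Qed.

Lemma smooth_derive1 f : smooth f -> smooth (derive1 f).
Proof. by move=> sf n x; rewrite -derive1Sn; exact: sf. Qed.

Lemma is_derive1E f g : (forall x, is_derive x 1 f (g x)) -> derive1 f = g.
Proof. by move=> fg; apply/funext => x; rewrite derive1E; apply: derive_val. Qed.

Lemma smooth_antiderivative f g :
  smooth g -> (forall x, is_derive x 1 f (g x)) -> smooth f.
Proof.
move=> sg fg [|n] x; first by have := fg x; move=> [].
by rewrite derive1Sn (is_derive1E fg).
Qed.

Lemma is_derive_translate f df (x h : R) : is_derive (x - h) 1 f df ->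
  is_derive x 1 (fun y => f (y - h)) df.
Proof.
move=> dfx; rewrite -[df]mulr1.
apply: (@is_derive1_comp R f (fun y => y - h)).
by rewrite -[X in is_derive _ _ _ X]subr0; apply: is_deriveB.
Qed.

Lemma smooth_shiftB f (h : R) : smooth f -> smooth (fun x => f x - f (x - h)).
Proof.
move=> sf.
apply: (smooth_coind (P := fun F => exists2 G, smooth G & F = fun x => G x - G (x - h))).
  move=> _ [G sG ->]; exists (fun x => derive1 G x - derive1 G (x - h)).
    by exists (derive1 G) => //; exact: smooth_derive1.
  move=> x; apply: is_deriveB; first exact: smooth_is_derive.
  by apply: is_derive_translate; exact: smooth_is_derive.
by exists f.
Qed.

(** One term of the exponential series at [v^-1], of degree [k + 2], already beats the pole with two
    powers of [v] to spare. *)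
Lemma exprV_expRN_le (k : nat) (v : R) : 0 < v ->
  v ^- k * expR (- v^-1) <= (k.+2)`!%:R * v ^+ 2.
Proof.
move=> v0; have vi0 : 0 < v^-1 by rewrite invr_gt0.
have := expR_ge1Dxn k.+1 (ltW vi0).
rewrite expRN ler_pdivrMr ?expR_gt0// => H.
have {}H : v^-1 ^+ k.+2 / (k.+2)`!%:R <= expR v^-1 by apply: le_trans H; lra.
have c0 : 0 <= (k.+2)`!%:R * v ^+ 2 by rewrite mulr_ge0// exprn_ge0// ltW.
apply: le_trans (ler_wpM2l c0 H).
rewrite -exprVn -addn2 exprD.
have f0 : (k + 2)`!%:R != 0 :> R by rewrite pnatr_eq0 -lt0n fact_gt0.
rewrite le_eqVlt; apply/orP; left; apply/eqP.
by field; rewrite f0 gt_eqF.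
Qed.

(** The flat function [exp(-1/u)], with a factor [p / u^k] added so that the family is closed under
    differentiation. *)
Definition flat_bump (u p : {poly R}) (k : nat) (x : R) : R :=
  if 0 < u.[x] then p.[x] * u.[x] ^- k * expR (- u.[x]^-1) else 0.

(** Numerator of the derivative once it is written over [u^(k+2)]. *)
Definition flat_bump_deriv (u p : {poly R}) (k : nat) : {poly R} :=
  p^`() * u ^+ 2 - k%:R *: (p * u^`() * u) + p * u^`().

(* At a zero [x0] of [u] the exponential beats the pole, so the function is
   [O((x - x0)^2)] there. *)
Lemma is_derive_flat_bump u p k x :
  is_derive x 1 (flat_bump u p k) (flat_bump u (flat_bump_deriv u p k) k.+2 x).
Proof.
have cu : {for x, continuous (horner u)} by exact: continuous_horner.
have [u0|u0|/eqP u0] := ltgtP (u.[x]) 0.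
- rewrite {2}/flat_bump ltNge (ltW u0)/=.
  apply: (@near_eq_is_derive _ _ _ (cst 0)).
  have : \forall y \near x, u.[y] < 0 by exact: (cvgr_lt _ cu _ u0).
  by apply: filterS => y uy; rewrite /flat_bump ltNge (ltW uy).
- rewrite {2}/flat_bump u0.
  pose F := horner p * (fun y => u.[y]^-1) ^+ k * (expR \o (- (fun y => u.[y]^-1))).
  apply: (@near_eq_is_derive _ _ _ F).
    have : \forall y \near x, 0 < u.[y] by exact: (cvgr_gt _ cu _ u0).
    apply: filterS => y uy; rewrite /flat_bump uy /F !fctE/=.
    by rewrite exprVn.
  have un0 : u.[x] != 0 by rewrite gt_eqF.
  have dV := @is_deriveV R (horner u) x _ 1 un0 (is_derive_poly _ _).
  apply: is_derive_eq.
  rewrite /= !fctE /flat_bump_deriv /GRing.scale /=.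
  rewrite !hornerE /= -!exprVn.
  case: k {F} => [|k]; rewrite ?expr0 /= ?exprS; field; rewrite ?un0//.
- have [q uq] := factor_theorem _ _ u0.
  have u0' : u.[x] = 0 by apply/eqP.
  rewrite {2}/flat_bump u0' ltxx.
  apply/is_derive1_caratheodory.
  (* Since [0^-1 = 0], this quotient is [0] at [z = x], the claimed derivative; continuity there is
     the real content. *)
  exists (fun z => flat_bump u p k z / (z - x)); split.
  + move=> z; rewrite {2}/flat_bump u0' ltxx subr0.
    have [->|zx] := eqVneq z x; last by rewrite divfK// subr_eq0.
    by rewrite subrr mulr0 /flat_bump u0' ltxx.
  + rewrite /prop_for /continuous_at subrr invr0 mulr0.
    (* As [u = q * ('X - x)], the bound by [u^2] divided by [|z - x|] leaves one factor
       [|z - x|]. *)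
    pose N z := `|p.[z]| * (k.+2)`!%:R * q.[z] ^+ 2 * `|z - x|.
    have N0 : N z @[z --> x] --> 0.
      have -> : 0 = N x by rewrite /N subrr normr0 mulr0.
      apply: cvgM; last first.
        by apply: cvg_norm; apply: cvgB; [exact: cvg_id|exact: cvg_cst].
      apply: cvgM; last by apply: cvgM; exact: continuous_horner.
      by apply: cvgMl; apply: cvg_norm; exact: continuous_horner.
    apply/norm_cvg0P; apply: squeeze_cvgr N0; last exact: cvg_cst.
    apply: nearW => z; rewrite normr_ge0/= normrM /N.
    have [->|zx] := eqVneq z x; first by rewrite subrr invr0 normr0 !mulr0.
    have zx0 : 0 < `|z - x| by rewrite normr_gt0 subr_eq0.
    rewrite normfV ler_pdivrMr// /flat_bump; case: ifPn => uz; last first.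
      rewrite normr0; do 2 (apply: mulr_ge0 => //).
      by apply: mulr_ge0; [exact: mulr_ge0|exact: sqr_ge0].
    rewrite -mulrA normrM -!mulrA ler_wpM2l//.
    rewrite ger0_norm ?mulr_ge0 ?expR_ge0 ?invr_ge0 ?exprn_ge0 ?(ltW uz)//.
    apply: (le_trans (exprV_expRN_le k uz)).
    rewrite ler_wpM2l// uq hornerM hornerXsubC exprMn -[(z - x) ^+ 2]real_normK ?num_real//.
    by rewrite !expr2 !mulrA.
  + by rewrite subrr invr0 mulr0.
Qed.

Lemma smooth_flat_bump u p k : smooth (flat_bump u p k).
Proof.
apply: (smooth_coind (P := fun f => exists p k, f = flat_bump u p k)).
  move=> _ [p1 [k1 ->]]; exists (flat_bump u (flat_bump_deriv u p1 k1) k1.+2).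
    by do 2!eexists.
  exact: is_derive_flat_bump.
by do 2!eexists.
Qed.

(** Takes [exp(-1/u)] for a quadratic [u] that is positive exactly between [a] and [b]. *)
Lemma smooth_bump_exists (a b : R) : a < b -> exists2 rho : R -> R, smooth rho &
  (forall x, a < x < b -> 0 < rho x) /\ (forall x, ~~ (a < x < b) -> rho x = 0).
Proof.
move=> ab; pose u : {poly R} := ('X - a%:P) * (b%:P - 'X).
exists (flat_bump u 1 0); first exact: smooth_flat_bump.
split=> x.
  move=> /andP[ax xb]; rewrite /flat_bump /u !hornerE /= mulr_gt0 ?subr_gt0//.
  by rewrite expr0 invr1 ?mul1r ?mulr1 expR_gt0.
move=> xab; rewrite /flat_bump; case: ifPn => //.
rewrite /u !hornerE => h; exfalso; move/negP: xab; apply.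
by apply/andP; split; rewrite ltNge; apply/negP => ?; nra.
Qed.
End SmoothFunctions.

(** * Second differences of continuous functions *)

Section SecondDifferences.
Variable R : realType.
Implicit Types (f F H psi : R -> R) (x y : R).

Lemma is_derive_continuous f F :
  (forall x, is_derive x 1 F (f x)) -> continuous F.
Proof.
by move=> dF x; apply/differentiable_continuous/derivable1_diffP; apply: ex_derive.
Qed.

Lemma smooth_continuous f : smooth f -> continuous f.
Proof. by move=> /smooth_is_derive/is_derive_continuous. Qed.

Lemma shift_continuous f (h : R) : continuous f -> continuous (fun x => f (x - h)).
Proof.
move=> cf x; apply: continuous_comp; last exact: cf.
by apply: cvgB; [exact: cvg_id|exact: cvg_cst].
Qed.

(** Outside the enlarged interval [f] vanishes between [x - h] and [x], so [F] agrees at both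
    ends. *)
Lemma antiderivative_shiftB_support f F (a b h : R) : a <= b -> 0 <= h ->
  (forall x, is_derive x 1 F (f x)) -> (forall x, x < a \/ b < x -> f x = 0) ->
  forall x, x < a \/ b + h < x -> F x - F (x - h) = 0.
Proof.
move=> ab h0 dF f0 x xab; apply/eqP; rewrite subr_eq0 eq_sym; apply/eqP.
apply: is_derive0_constant dF _; first by rewrite gerBl.
by move=> y /andP[xy yx]; apply: f0; case: xab => ?; [left|right]; lra.
Qed.

(* The second derivative of [psi] is a combination of four translates of a
   bump [rho], so testing against it averages the second difference. *)
Lemma second_difference_eq0 H : continuous H ->
  (forall psi, test_function psi ->
     \int[lebesgue_measure]_t (H t * derive1n 2 psi t) = 0) ->
  forall x (h L : R), 0 <= h -> 0 <= L ->
    H (x + h) - H x = H (x + (L + h)) - H (x + L).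
Proof.
move=> cH Hpsi x h L h0 L0.
(* If [Z x] is nonzero, then [Z] is nonzero on a neighbourhood of [x], where a bump detects it. *)
pose Z y := H y - H (y + h) - (H (y + L) - H (y + (L + h))).
suff : Z x = 0 by rewrite /Z; lra.
apply/eqP; apply/negPn/negP => Zx.
have cHs (s : R) : continuous (fun y => H (y + s)).
  by move=> y; have := @shift_continuous H (- s) cH y; rewrite opprK.
have cZ : continuous Z.
  by move=> y; apply: cvgB; apply: cvgB; [exact: cH|exact: cHs..].
have : \forall y \near x, Z y != 0 by exact: (cvgr_neq0 _ (cZ x)).
move=> /nbhs_ballP[e /= e0 Ze].
pose a := x - e; pose b := x + e.
have ab : a < b by rewrite /a /b; lra.
have Zab y : a < y < b -> Z y != 0.
  move=> /andP[ay yb]; apply: Ze; rewrite /ball/= ltr_norml.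
  by move: ay yb; rewrite /a /b; lra.
have [rho srho [rho_gt0 rho_out]] := smooth_bump_exists ab.
have rho0 y : y < a \/ b < y -> rho y = 0.
  by move=> yab; apply: rho_out; apply/negP => /andP[? ?]; case: yab; lra.
have crho := smooth_continuous srho.
have [S dS] := antiderivative_exists crho.
(* Subtracting a translate restores compact support after each integration: shift [h] here, shift
   [L] for [psi]. *)
pose q y := S y - S (y - h).
have sq : smooth q by apply: smooth_shiftB; exact: smooth_antiderivative dS.
have [Q dQ] := antiderivative_exists (smooth_continuous sq).
pose psi y := Q y - Q (y - L).
have q0 : forall y, y < a \/ b + h < y -> q y = 0.
  by apply: antiderivative_shiftB_support dS rho0 => //; exact: ltW.
have psi0 : forall y, y < a \/ b + h + L < y -> psi y = 0.
  by apply: antiderivative_shiftB_support dQ q0 => //; lra.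
have tpsi : test_function psi.
  split; last by exists a, (b + h + L).
  by apply: smooth_shiftB; exact: smooth_antiderivative dQ.
have dpsi : derive1 psi = fun y => q y - q (y - L).
  by apply: is_derive1E => y; apply: is_deriveB; exact: (is_derive_translate (dQ _)).
have d2psi : derive1n 2 psi =
    fun y => rho y - rho (y - h) - (rho (y - L) - rho (y - L - h)).
  rewrite derive1nS derive1n1 dpsi; apply: is_derive1E => y.
  have dq (z : R) : is_derive z 1 q (rho z - rho (z - h)).
    by apply: is_deriveB; exact: (is_derive_translate (dS _)).
  by apply: is_deriveB; exact: (is_derive_translate (dq _)).
(* Translating [H] instead of [rho] brings the four terms of [H * psi''] onto the same support. *)
have YE (s : R) : exists Y, forall y, is_derive y 1 Y (H (y + s) * rho y).
  by apply: antiderivative_exists => y; apply: cvgM; [exact: cHs|exact: crho].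
have Yl (s : R) Y (dY : forall y, is_derive y 1 Y (H (y + s) * rho y)) y :
    y <= a -> Y y = Y a.
  move=> ya; apply: is_derive0_constant dY _ => // z zya.
  by rewrite rho0 ?mulr0//; left; lra.
have Yr (s : R) Y (dY : forall y, is_derive y 1 Y (H (y + s) * rho y)) y :
    b <= y -> Y y = Y b.
  move=> yb; symmetry; apply: is_derive0_constant dY _ => // z zya.
  by rewrite rho0 ?mulr0//; right; lra.
have [Y1 dY1] := YE 0; have [Y2 dY2] := YE h.
have [Y3 dY3] := YE L; have [Y4 dY4] := YE (L + h).
pose V y := Y1 y - Y2 (y - h) - (Y3 (y - L) - Y4 (y - (L + h))).
have dV y : is_derive y 1 V (H y * derive1n 2 psi y).
  have := is_deriveB (is_deriveB (dY1 y) (is_derive_translate (dY2 (y - h))))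
    (is_deriveB (is_derive_translate (dY3 (y - L)))
                (is_derive_translate (dY4 (y - (L + h))))).
  move=> dh; apply: (is_derive_eq dh); rewrite d2psi.
  by rewrite addr0 !subrK (_ : y - (L + h) = y - L - h); ring.
have cg : continuous (fun y => H y * derive1n 2 psi y).
  move=> y; apply: cvgM; first exact: cH.
  by apply: smooth_continuous; do 2!apply: smooth_derive1; exact: tpsi.1.
pose A := a - 1; pose B := b + h + L + 1.
have := Hpsi _ tpsi.
rewrite (@Rintegral_compact_support R _ V A B)//; last 2 first.
- by rewrite /A /B; lra.
- move=> y yAB; rewrite d2psi !rho0 ?subr0 ?mulr0//;
    case: yAB; rewrite /A /B => ?; [left|right|left|right|left|right|left|right]; lra.
rewrite /V.
rewrite (Yl _ _ dY1 A) ?(Yl _ _ dY2 (A - h)) ?(Yl _ _ dY3 (A - L))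
  ?(Yl _ _ dY4 (A - (L + h))) ?(Yr _ _ dY1 B) ?(Yr _ _ dY2 (B - h))
  ?(Yr _ _ dY3 (B - L)) ?(Yr _ _ dY4 (B - (L + h))); try (rewrite /A /B; lra).
(* [Y b - Y a] is the vanishing integral of [H * psi''], yet the mean value theorem makes it
   [Z c * rho c * (b - a)]. *)
pose Y y := Y1 y - Y2 y - (Y3 y - Y4 y).
have dY y : is_derive y 1 Y (Z y * rho y).
  have := is_deriveB (is_deriveB (dY1 y) (dY2 y)) (is_deriveB (dY3 y) (dY4 y)).
  move=> dh; apply: (is_derive_eq dh).
  by rewrite /= addr0 /Z; ring.
have [|c] := MVT ab (fun y _ => dY y).
  exact/continuous_subspaceT/is_derive_continuous.
rewrite in_itv/= => cab Yab.
have : Y b - Y a != 0.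
  by rewrite Yab !mulf_neq0 ?Zab ?gt_eqF ?rho_gt0// subr_gt0.
by move=> /eqP + VV; apply; move: VV; rewrite /Y; lra.
Qed.

End SecondDifferences.

(** * From the weak equation to a second-difference identity *)

Section WeakForm.
Variable R : realType.
Implicit Types (f F W A G phi psi : R -> R) (x y : R).

Lemma derive1_support f (a b : R) : (forall x, x < a \/ b < x -> f x = 0) ->
  forall x, x < a \/ b < x -> derive1 f x = 0.
Proof.
move=> f0 x xab; rewrite derive1E.
have -> : 'D_1 f x = 'D_1 (cst 0 : R -> R) x; last exact: derive_cst.
apply: near_eq_derive; case: xab => xab.
  by near=> y; apply: f0; left; near: y; exact: lt_nbhsl.
by near=> y; apply: f0; right; near: y; exact: lt_nbhsr.
Unshelve. all: by end_near. Qed.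

(** Integration by parts turns the weak form into the vanishing of the integral of [H * psi''] for
    every test function. *)
Lemma weak_form_second_difference (c : R) phi W f F A G :
  continuous phi -> continuous W -> continuous f ->
  (forall x, is_derive x 1 A (phi x)) ->
  (forall x, is_derive x 1 F (f x)) ->
  (forall x, is_derive x 1 G (F x)) ->
  (forall psi, test_function psi -> \int[lebesgue_measure]_t
     (c * phi t * derive1 psi t + W t * derive1n 2 psi t - f t * psi t) = 0) ->
  let H y := W y - c * A y - G y in
  forall x (h L : R), 0 <= h -> 0 <= L ->
    H (x + h) - H x = H (x + (L + h)) - H (x + L).
Proof.
move=> cphi cW cf dA dF dG weak H.
have cH : continuous H.
  move=> y; apply: cvgB; last exact: (is_derive_continuous dG).
  by apply: cvgB; [exact: cW|apply: cvgMr; exact: (is_derive_continuous dA)].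
apply: second_difference_eq0 => // psi tpsi.
have [spsi [a0 [b0 psi0']]] := tpsi.
(* The margin gives [a < b] even if [b0 <= a0], and puts both end points where [psi] and its
   derivatives vanish. *)
pose a := Num.min a0 b0 - 1; pose b := Num.max a0 b0 + 1.
have ab : a < b.
  have : Num.min a0 b0 <= a0 by rewrite ge_min lexx.
  have : a0 <= Num.max a0 b0 by rewrite le_max lexx.
  by rewrite /a /b; lra.
have supp y : y <= a \/ b <= y -> y < a0 \/ b0 < y.
  have : Num.min a0 b0 <= a0 by rewrite ge_min lexx.
  have : b0 <= Num.max a0 b0 by rewrite le_max lexx orbT.
  by rewrite /a /b; move=> ? ? [?|?]; [left|right]; lra.
have psi1' := derive1_support psi0'.
have psi2' : forall y, y < a0 \/ b0 < y -> derive1n 2 psi y = 0.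
  exact: derive1_support psi1'.
have s1 := smooth_derive1 spsi.
have dpsi := smooth_is_derive spsi.
have dpsi1 : forall y, is_derive y 1 (derive1 psi) (derive1n 2 psi y).
  exact: smooth_is_derive s1.
have cpsi := smooth_continuous spsi.
have cpsi1 := smooth_continuous s1.
have cpsi2 : continuous (derive1n 2 psi) := smooth_continuous (smooth_derive1 s1).
pose g t := c * phi t * derive1 psi t + W t * derive1n 2 psi t - f t * psi t.
have cg : continuous g.
  move=> y; apply: cvgB; last by apply: cvgM; [exact: cf|exact: cpsi].
  apply: cvgD; last by apply: cvgM; [exact: cW|exact: cpsi2].
  by apply: cvgM; [apply: cvgMr; exact: cphi|exact: cpsi1].
have [X dX] := antiderivative_exists cg.
have weak_psi : \int[lebesgue_measure]_t g t = 0 := weak _ tpsi.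
rewrite (Rintegral_compact_support ab cg dX) in weak_psi; last first.
  move=> y yab; have {}yab : y < a0 \/ b0 < y by apply: supp; case: yab => /ltW; [left|right].
  by rewrite /g psi0'// psi1'// psi2'// !mulr0 addr0 subr0.
(* The boundary terms of the integration by parts: [g] minus the derivative of [U] is
   [H * psi'']. *)
pose U y := c * A y * derive1 psi y - F y * psi y + G y * derive1 psi y.
have dU y : is_derive y 1 U
   (c * phi y * derive1 psi y - f y * psi y + (c * A y + G y) * derive1n 2 psi y).
  have dh := is_deriveD (is_deriveB (is_deriveM (is_deriveM (is_derive_cst c y 1) (dA y)) (dpsi1 y))
    (is_deriveM (dF y) (dpsi y))) (is_deriveM (dG y) (dpsi1 y)).
  apply: (is_derive_eq dh).
  rewrite /GRing.scale /= !fctE; ring.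
have cHpsi : continuous (fun y => H y * derive1n 2 psi y).
  by move=> y; apply: cvgM; [exact: cH|exact: cpsi2].
have dXU y : is_derive y 1 (X - U) (H y * derive1n 2 psi y).
  by apply: (is_derive_eq (is_deriveB (dX y) (dU y))); rewrite /g /H; ring.
rewrite (Rintegral_compact_support ab cHpsi dXU).
  have -> : (X - U) b - (X - U) a = X b - X a - (U b - U a) by rewrite !fctE; ring.
  have [sa sb] : (a < a0 \/ b0 < a) /\ (b < a0 \/ b0 < b).
    by split; apply: supp; [left|right].
  rewrite weak_psi /U (psi0' a)// (psi0' b)// (psi1' a)// (psi1' b)// !mulr0.
  by lra.
move=> y yab; have {}yab : y < a0 \/ b0 < y.
  by apply: supp; case: yab => /ltW; [left|right].
by rewrite psi2' // mulr0.
Qed.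
End WeakForm.

(** * Upper bound for the increments of the flux *)

Section Increment.
Variable R : realType.

(* The second-difference identity is used with a base point sent to [-oo],
   where [W] vanishes; shifting the delay onto the antiderivative of [b \o phi]
   leaves the nonnegative reaction [b - d] up to time [x - delta]. *)
Lemma profile_increment_le (c delta kappa eta T t1 : R)
    (phi W b d A B E G : R -> R) :
  0 <= c -> 0 <= delta -> 0 <= eta ->
  (forall x : R, is_derive x 1 A (phi x)) ->
  (forall x : R, is_derive x 1 B (b (phi x))) ->
  (forall x : R, is_derive x 1 E (d (phi x))) ->
  (forall x : R, is_derive x 1 G (E x - B (x - delta))) ->
  (let H y := W y - c * A y - G y in
   forall x h L : R, 0 <= h -> 0 <= L ->
     H (x + h) - H x = H (x + (L + h)) - H (x + L)) ->
  (forall t, 0 <= phi t) ->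
  (forall x y, x <= y -> y <= T -> phi x <= phi y) -> phi T <= kappa ->
  (forall s, 0 <= s -> 0 <= b s) ->
  (forall s, 0 <= s <= kappa -> d s <= d kappa) ->
  (forall s, 0 <= s <= kappa -> d s <= b s) ->
  (forall s, phi t1 <= s <= phi T -> eta <= b s - d s) ->
  (forall t, 0 <= W t) ->
  (forall e, 0 < e -> exists t, forall s, s <= t -> W s <= e) ->
  forall x h : R, 0 <= h -> x + h <= T -> t1 <= x - delta ->
    W (x + h) - W x <= (c * kappa + delta * d kappa - eta * (x - delta - t1)) * h.
Proof.
move=> c0 delta0 eta0 dA dB dE dG Hdiff phi0 phi_nd phiT b0 dk db eta_le W0 Wlim.
move=> x h h0 xhT t1x; apply/ler_addgt0Pr => e e0.
have phik y : y <= T -> phi y <= kappa by move=> yT; apply: le_trans (phi_nd y T _ _) phiT.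
have [t Wt] := Wlim _ e0.
(* Far enough back for [x - L + h] to precede [t], where [W] is at most [e], and also [t1]. *)
pose L := `|x + h - t| + `|x + h - t1|.
have L0 : 0 <= L by rewrite addr_ge0.
have Lt : x - L + h <= t.
  by rewrite /L; have := ler_norm (x + h - t); have := normr_ge0 (x + h - t1); lra.
have Lt1 : x - L + h <= t1.
  by rewrite /L; have := ler_norm (x + h - t1); have := normr_ge0 (x + h - t); lra.
have := Hdiff (x - L) h L h0 L0.
rewrite (_ : x - L + (L + h) = x + h); last by ring.
rewrite subrK => HL.
have xxh : x <= x + h by rewrite lerDl.
have hA : A (x + h) - A x <= kappa * (x + h - x).
  by apply: is_derive_increment_le dA _ => // y /andP[_ yx]; apply: phik; lra.
have hA' : 0 * (x - L + h - (x - L)) <= A (x - L + h) - A (x - L).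
  by apply: is_derive_increment_ge dA _; rewrite ?lerDl.
pose M := delta * d kappa - eta * (x - delta - t1).
(* The derivative regroups as the increment of [E] over [[y - delta, y]], minus that of [B] over
   [[y - L - delta, y - L]], minus that of [B - E] over [[y - L, y - delta]], the last split at
   [t1]. *)
have hG : (G (x + h) - G (x + h - L)) - (G x - G (x - L)) <= M * (x + h - x).
  have dK (y : R) : is_derive y 1 (fun s => G s - G (s - L))
      ((E y - B (y - delta)) - (E (y - L) - B (y - L - delta))).
    exact: is_deriveB (dG y) (is_derive_translate (dG (y - L))).
  apply: (is_derive_increment_le xxh dK) => y /andP[xy yxh].
  have hE : E y - E (y - delta) <= d kappa * (y - (y - delta)).
    apply: is_derive_increment_le dE _; first by rewrite gerBl.
    by move=> z /andP[_ zy]; apply: dk; rewrite phi0/= phik//; lra.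
  have hB : 0 * (y - L - (y - L - delta)) <= B (y - L) - B (y - L - delta).
    by apply: is_derive_increment_ge dB _; [rewrite gerBl|move=> z _; exact: b0].
  have dBE (z : R) : is_derive z 1 (B - E) (b (phi z) - d (phi z)).
    exact: is_deriveB.
  have hBE1 : 0 * (t1 - (y - L)) <= (B - E) t1 - (B - E) (y - L).
    apply: is_derive_increment_ge dBE _; first lra.
    by move=> z /andP[_ zt1]; rewrite subr_ge0 db// phi0 phik//; lra.
  have hBE2 : eta * (y - delta - t1) <= (B - E) (y - delta) - (B - E) t1.
    apply: is_derive_increment_ge dBE _; first lra.
    by move=> z /andP[t1z zy]; apply: eta_le; rewrite !phi_nd//; lra.
  have : eta * (x - delta - t1) <= eta * (y - delta - t1) by rewrite ler_wpM2l//; lra.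
  by move: hBE1 hBE2; rewrite !fctE /M; lra.
have W1 := Wt _ Lt; have W2 := W0 (x - L).
have hcA : c * (A (x + h) - A x) <= c * (kappa * h).
  by rewrite ler_wpM2l//; move: hA; rewrite [x + h - x]addrAC subrr add0r.
have hcA' : 0 <= c * (A (x - L + h) - A (x - L)).
  by rewrite mulr_ge0//; move: hA'; rewrite mul0r.
have E1 : G (x + h - L) = G (x - L + h) by congr G; ring.
rewrite E1 (_ : x + h - x = h) in hG; last by ring.
rewrite (_ : _ * h = c * (kappa * h) + M * h); last by rewrite /M; ring.
by lra.
Qed.
End Increment.

(** * Consequences of the standing assumptions *)

Section Reaction.
Variable R : realType.

(** The rates are continuous only relative to the half-line, which [phi] never leaves. *)
Lemma within_nonneg_comp_continuous (f phi : R -> R) :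
  {within `[0, +oo[, continuous f} -> continuous phi -> (forall t, 0 <= phi t) ->
  continuous (fun t => f (phi t)).
Proof.
move=> cf cphi phi0 y U /= fU.
have : nbhs_subspace (phi y : subspace `[0, +oo[) (f @^-1` U) := cf (phi y) U fU.
rewrite -nbhs_subspace_in; last by rewrite /= in_itv/= phi0.
rewrite /within/= => /(cphi y); apply: (@filterS _ (nbhs y)) => z /= zU.
by apply: zU; rewrite in_itv/= phi0.
Qed.

Lemma within_nonneg_segment (f : R -> R) (s1 s2 : R) : 0 <= s1 ->
  {within `[0, +oo[, continuous f} -> {within `[s1, s2], continuous f}.
Proof.
move=> s10; apply: continuous_subspaceW => s /=.
by rewrite !in_itv/= andbT => /andP[+ _]; exact: le_trans.
Qed.

Variables (b b1 d d1 d2 : R -> R) (kappa sM : R).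
Hypothesis std : standing_assumptions b b1 d d1 d2 kappa sM.

Lemma death_within_continuous : {within `[0, +oo[, continuous d}.
Proof. by have [[[[]]]] := std. Qed.

Lemma birth_within_continuous : {within `[0, +oo[, continuous b}.
Proof. by have [_ [[[]]]] := std. Qed.

Lemma birth_ge0 s : 0 <= s -> 0 <= b s.
Proof. by have [_ [[_ + _] _]] := std; exact. Qed.

Lemma kappa_gt0 : 0 < kappa.
Proof. by have [_ [_ [_ []]]] := std. Qed.

Lemma death_le s : 0 <= s <= kappa -> d s <= d kappa.
Proof.
have [[[[_ [_ [dd _]]] _] _ d1_gt0 _] _] := std.
move=> /andP[s0]; rewrite le_eqVlt => /predU1P[->//|sk].
have [||x xsk] := @MVT R d d1 s kappa sk.
- by move=> x; rewrite in_itv/= => /andP[sx _]; apply: dd; lra.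
- exact: within_nonneg_segment death_within_continuous.
move: xsk; rewrite in_itv/= => /andP[sx xk] dE.
rewrite -subr_ge0 dE mulr_ge0 ?subr_ge0 1?ltW// d1_gt0//; lra.
Qed.

Lemma death_le_birth s : 0 <= s <= kappa -> d s <= b s.
Proof.
have [[_ d0 _ _] [[_ _ b0] [_ [k0 bk _ _ db]]]] := std.
move=> /andP[]; rewrite le_eqVlt => /predU1P[<-|s0]; first by rewrite d0 b0.
rewrite le_eqVlt => /predU1P[->|sk]; first by rewrite bk.
by apply/ltW; apply: (db s _).1; rewrite s0.
Qed.

Lemma death_kappa_ge0 : 0 <= d kappa.
Proof.
have [_ [_ [_ [k0 <- _ _ _]]]] := std.
by apply: birth_ge0; exact: ltW.
Qed.

(** [b - d] attains its minimum on the compact interval, and is positive there. *)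
Lemma reaction_gap (s1 s2 : R) : 0 < s1 -> s1 <= s2 -> s2 < kappa ->
  exists2 eta, 0 < eta & forall s, s1 <= s <= s2 -> eta <= b s - d s.
Proof.
move=> s10 s12 s2k.
have [_ [_ [_ [_ _ _ _ db]]]] := std.
have [|s + smin] := @EVT_min R (fun s => b s - d s) s1 s2 s12.
  move=> s; apply: cvgB; apply: within_nonneg_segment; rewrite ?ltW//.
    exact: birth_within_continuous.
  exact: death_within_continuous.
rewrite in_itv/= => /andP[s1s ss2]; exists (b s - d s).
  by rewrite subr_gt0; apply: (db s _).1; apply/andP; split; lra.
by move=> t ts; apply: smin; rewrite in_itv.
Qed.

End Reaction.

(** * Wave profiles and the constraint on their speed *)

Section Waves.
Variables (R : realType) (m D : R) (b b1 d d1 d2 : R -> R) (kappa sM : R).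
Hypotheses (m_gt1 : 1 < m) (D_gt0 : 0 < D).
Hypothesis std : standing_assumptions b b1 d d1 d2 kappa sM.

Let s1 := kappa / 4.
Let s2 := 3 * kappa / 4.

Lemma flux_le (x y : R) : 0 <= x -> x <= y -> D * x `^ m <= D * y `^ m.
Proof.
move=> x0 xy; rewrite ler_wpM2l ?(ltW D_gt0)//.
by have m1 := m_gt1; apply: ge0_ler_powR => //; rewrite ?nnegrE; lra.
Qed.

Lemma flux_lt (x y : R) : 0 <= x -> x < y -> D * x `^ m < D * y `^ m.
Proof.
move=> x0 xy; rewrite ltr_pM2l//.
by have m1 := m_gt1; apply: gt0_ltr_powR => //; rewrite ?nnegrE; lra.
Qed.

(** Transfers the decay of the profile at [-oo] to the flux. *)
Lemma flux_le_linear (x : R) : 0 <= x <= 1 -> D * x `^ m <= D * x.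
Proof.
move=> /andP[x0 x1]; rewrite ler_wpM2l ?(ltW D_gt0)//.
move: x0; rewrite le_eqVlt => /predU1P[<-|x0].
  by rewrite powR0// gt_eqF// (lt_trans _ m_gt1).
by apply: ge1r_powR; rewrite ?x0// ltW.
Qed.

(** * Estimates for a single profile *)

Section Profile.
Variables (c r : R) (phi : R -> R) (t0 : \bar R).
Hypotheses (c_gt0 : 0 < c) (r_ge0 : 0 <= r).
Hypotheses (phi_ge0 : forall t, 0 <= phi t) (cphi : continuous phi)
  (cW : continuous (fun t => phi t `^ m))
  (sol : distributional_solution m D c r b d phi)
  (phiNy : phi x @[x --> -oo] --> 0) (phi_nd : nondecr_before phi t0).

Let Gam := c * kappa + c * r * d kappa.

Lemma profile_vanishes (e : R) : 0 < e -> exists t, forall s, s <= t -> phi s <= e.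
Proof.
move=> e0; move/cvgrPdist_lt : phiNy => /(_ e e0)[M [_ HM]].
exists (M - 1) => s sM'; have := HM s; rewrite sub0r normrN => /(_ _)/ltW.
by rewrite ger0_norm//; apply; lra.
Qed.

Lemma wave_increment_le (T t1 eta : R) : (T%:E < t0)%E -> phi T <= kappa ->
  0 <= eta -> (forall s, phi t1 <= s <= phi T -> eta <= b s - d s) ->
  forall x h : R, 0 <= h -> x + h <= T -> t1 <= x - c * r ->
    D * phi (x + h) `^ m - D * phi x `^ m <= (Gam - eta * (x - c * r - t1)) * h.
Proof.
move=> Tt0 phiT eta0 eta_le.
have [A dA] := antiderivative_exists cphi.
have cb := within_nonneg_comp_continuous (birth_within_continuous std) cphi phi_ge0.
have cd := within_nonneg_comp_continuous (death_within_continuous std) cphi phi_ge0.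
have [B dB] := antiderivative_exists cb.
have [E dE] := antiderivative_exists cd.
pose F t := E t - B (t - c * r).
pose f t := d (phi t) - b (phi (t - c * r)).
have dF (t : R) : is_derive t 1 F (f t).
  exact: is_deriveB (dE t) (is_derive_translate (dB _)).
have cf : continuous f.
  by move=> t; apply: cvgB; [exact: cd|exact: (shift_continuous cb)].
have [G dG] := antiderivative_exists (is_derive_continuous dF).
apply: (profile_increment_le (W := fun t => D * phi t `^ m) _ _ _ dA dB dE dG) => //.
- exact: ltW.
- by rewrite mulr_ge0// ltW.
- apply: (weak_form_second_difference (f := f) _ _ _ dA dF dG) => //.
    by move=> t; apply: cvgMr; exact: cW.
  move=> psi tpsi; have [_ <-] := sol tpsi.
  by apply: eq_Rintegral => t _; rewrite /weak_integrand /f; ring.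
- by move=> x y xy yT; apply: phi_nd => //; apply: le_lt_trans Tt0; rewrite lee_fin.
- exact: (birth_ge0 std).
- exact: (death_le std).
- exact: (death_le_birth std).
- by move=> t; rewrite mulr_ge0 ?powR_ge0// ltW.
- move=> e e0; have e' : 0 < Num.min 1 (e / D) by rewrite lt_min ltr01 divr_gt0.
  have [t Ht] := profile_vanishes e'; exists t => s /Ht.
  rewrite le_min => /andP[phi1]; rewrite ler_pdivlMr// => phie.
  by apply: le_trans (flux_le_linear _) _; rewrite ?phi_ge0// mulrC.
Qed.

(** Intermediate values between [s] and a point far to the left, where [phi] is at most [v / 2]. *)
Lemma profile_hits (s v : R) : 0 < v -> v <= phi s -> exists2 t, t <= s & phi t = v.
Proof.
move=> v0 vs; have v20 : 0 < v / 2 by lra.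
have [t Ht] := profile_vanishes v20.
have ms : Num.min t s <= s by rewrite ge_min lexx orbT.
have mt : phi (Num.min t s) <= v / 2 by apply: Ht; rewrite ge_min lexx.
have [||u] := @IVT R phi (Num.min t s) s v ms.
- exact: continuous_subspaceT.
- by rewrite ge_min le_max vs orbT andbT; apply/orP; left; lra.
by rewrite in_itv/= => /andP[_ us] <-; exists u.
Qed.

Lemma Gam_ge0 : 0 <= Gam.
Proof.
have k0 := kappa_gt0 std; have dk := death_kappa_ge0 std.
by rewrite /Gam addr_ge0 ?mulr_ge0// ltW.
Qed.

(** The duration [l] of the climb from [s1] to [s2] is bounded below by the flux rate and above by
    the accumulated reaction; eliminating [l] gives the claim. *)
Lemma transition_speed (eta s : R) : 0 < eta ->
  (forall s, s1 <= s <= s2 -> eta <= b s - d s) ->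
  (s%:E < t0)%E -> s2 <= phi s ->
  eta * (D * s2 `^ m - D * s1 `^ m) <= 2 * Gam * (Gam + eta * (c * r)).
Proof.
move=> eta0 eta_le st0 phis.
have k0 := kappa_gt0 std; have G0 := Gam_ge0.
have cr0 : 0 <= c * r by rewrite mulr_ge0// ltW.
have [|T Ts phiT] := profile_hits _ phis; first by rewrite /s2; lra.
have Tt0 : (T%:E < t0)%E by apply: le_lt_trans st0; rewrite lee_fin.
have phiTk : phi T <= kappa by rewrite phiT /s2; lra.
have [||t1 t1T phit1] := @profile_hits T s1; rewrite ?phiT /s1 /s2; [lra..|].
have nd x : x <= T -> phi x <= phi T by move=> xT; apply: phi_nd.
pose l := T - t1.
have l0 : 0 <= l by rewrite subr_ge0.
have tl : t1 + l = T by rewrite /l addrC subrK.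
(* Uses [eta = 0] and the base time [t1 - c * r], so only the rate [Gam] remains. *)
have step1 : D * s2 `^ m - D * s1 `^ m <= Gam * l.
  rewrite -phiT -phit1.
  have := @wave_increment_le T (t1 - c * r) 0 Tt0 phiTk (lexx _) _ t1 l l0.
  rewrite tl mul0r subr0; apply => // u /andP[u1 u2].
  rewrite subr_ge0; apply: (death_le_birth std).
  by rewrite (le_trans (phi_ge0 _) u1) (le_trans u2).
(* On the second half of the climb the delayed time is at least [l / 2 - c * r] past [t1]; were the
   claim false, the flux would strictly decrease there. *)
have step2 : eta * (l / 2 - c * r) <= Gam.
  have [lcr|crl] := leP (l / 2) (c * r).
    by apply: le_trans G0; apply: mulr_ge0_le0; [exact: ltW|lra].
  rewrite leNgt; apply/negP => bad.
  have xl : t1 + l / 2 + l / 2 = T by rewrite -tl; field.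
  have : D * phi T `^ m - D * phi (t1 + l / 2) `^ m <=
      (Gam - eta * (t1 + l / 2 - c * r - t1)) * (l / 2).
    rewrite -{1}xl; apply: wave_increment_le Tt0 phiTk (ltW eta0) _ _ _ _ _ _.
    - by move=> u; rewrite phit1 phiT; exact: eta_le.
    - lra.
    - lra.
    - lra.
  have : D * phi (t1 + l / 2) `^ m <= D * phi T `^ m.
    by apply: flux_le => //; apply: nd; lra.
  rewrite (_ : t1 + l / 2 - c * r - t1 = l / 2 - c * r); last by ring.
  have : 0 < (eta * (l / 2 - c * r) - Gam) * (l / 2) by rewrite mulr_gt0//; lra.
  lra.
have : eta * (Gam * l) <= Gam * (2 * Gam + 2 * eta * (c * r)).
  rewrite mulrCA ler_wpM2l//; lra.
have : eta * (D * s2 `^ m - D * s1 `^ m) <= eta * (Gam * l).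
  by rewrite ler_wpM2l// ltW.
lra.
Qed.

(** A profile trapped between [e] and [s2] would keep the reaction uniformly positive, and its
    growing integral would end the monotonicity. *)
Lemma profile_exceeds (e : R) : 0 < e -> (\forall t \near +oo, e <= phi t) ->
  t0 = +oo%E -> exists s, s2 <= phi s.
Proof.
move=> e0 [M [_ HM]] t0y; apply/not_existsP => Hlt.
have k0 := kappa_gt0 std; have G0 := Gam_ge0.
have cr0 : 0 <= c * r by rewrite mulr_ge0// ltW.
have phi_lt t : phi t < s2 by rewrite ltNge; apply/negP; exact: Hlt.
pose t1 := M + 1.
have et1 : e <= phi t1 by apply: HM; rewrite /t1; lra.
have [||eta eta0 eta_le] := reaction_gap std e0 (s2 := s2).
- by apply: le_trans et1 (ltW (phi_lt _)).
- by rewrite /s2; lra.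
(* Chosen so that [eta * X = Gam + eta]: the flux would drop by at least [eta] over [[x, x + 1]]. *)
pose X := Gam / eta + 1; pose x := t1 + c * r + X.
have X0 : 0 <= Gam / eta by rewrite divr_ge0// ltW.
have Tt0 : ((x + 1)%:E < t0)%E by rewrite t0y ltry.
have phik : phi (x + 1) <= kappa by have := phi_lt (x + 1); rewrite /s2; lra.
have : D * phi (x + 1) `^ m - D * phi x `^ m <= (Gam - eta * (x - c * r - t1)) * 1.
  apply: wave_increment_le Tt0 phik (ltW eta0) _ _ _ _ _ _ => //.
  - move=> u /andP[u1 u2]; apply: eta_le.
    by rewrite (le_trans et1 u1) (le_trans u2) ?ltW.
  - by rewrite /x /X; lra.
have : D * phi x `^ m <= D * phi (x + 1) `^ m.
  by apply: flux_le => //; apply: phi_nd => //; lra.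
have -> : x - c * r - t1 = X by rewrite /x; ring.
have -> : eta * X = Gam + eta by rewrite /X; field; rewrite gt_eqF.
lra.
Qed.

End Profile.

(** It suffices to reach level [s2] before [t0]: by continuity just left of a finite [t0], where
    [phi] exceeds [kappa], and by [profile_exceeds] otherwise. *)
Lemma wave_speed_bound (c r : R) (phi : R -> R) : 0 < c -> 0 <= r ->
  wave_solution m D c r kappa b d phi ->
  forall eta, 0 < eta -> (forall s, s1 <= s <= s2 -> eta <= b s - d s) ->
  eta * (D * s2 `^ m - D * s1 `^ m) <= 2 * (c * kappa + c * r * d kappa) *
    (c * kappa + c * r * d kappa + eta * (c * r)).
Proof.
move=> c0 r0 wave eta eta0 eta_le.
have [[phi0 Wphi _ Wphim sol] [[phiNy [e e0 phie] _] [t0 [t0Ny phi_nd _ phit0]]]] :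
  semi_wavefront m D c r kappa b d phi by case: wave => // -[].
have cphi := W11loc_continuous Wphi; have cW := W11loc_continuous Wphim.
have k0 := kappa_gt0 std.
suff [s st0 phis] : exists2 s, (s%:E < t0)%E & s2 <= phi s.
  exact: transition_speed st0 phis.
case: t0 t0Ny phi_nd phit0 => [t0r _ _ /(_ t0r erefl) kphi|_ phi_nd _|//].
- have : \forall t \near t0r, s2 < phi t.
    by apply: (cvgr_gt _ (cphi t0r)); rewrite /s2; lra.
  move=> /nbhs_ballP[del /= del0 Hdel].
  exists (t0r - del / 2); first by rewrite lte_fin; lra.
  apply/ltW/Hdel; rewrite /ball/= opprB addrC subrK gtr0_norm; lra.
- have [s phis] := profile_exceeds c0 r0 phi0 cphi cW sol phiNy phi_nd e0 phie erefl.
  by exists s => //; rewrite ltry.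
Qed.

End Waves.

(** * Choice of the threshold speed and its asymptotics *)

Theorem theorem2p2 (R : realType) (m D : R) (b b1 d d1 d2 : R -> R) (kappa sM : R) :
  1 < m -> 0 < D ->
  standing_assumptions b b1 d d1 d2 kappa sM ->
  exists cdot : R -> R, exists2 mu0 : R, 0 < mu0 &
    (forall r : R, 0 <= r ->
       0 < cdot r /\
       forall c : R, 0 < c < cdot r ->
         forall phi : R -> R, ~ wave_solution m D c r kappa b d phi) /\
    (r * cdot r @[r --> +oo] --> mu0).
Proof.
move=> m1 D0 std.
have k0 := kappa_gt0 std; have dk := death_kappa_ge0 std.
have [|||eta eta0 eta_le] := @reaction_gap R _ _ _ _ _ _ _ std (kappa / 4) (3 * kappa / 4).
- lra.
- lra.
- lra.
pose J := D * (3 * kappa / 4) `^ m - D * (kappa / 4) `^ m.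
have J0 : 0 < J by rewrite subr_gt0; apply: flux_lt => //; lra.
pose K := kappa + d kappa.
have K0 : 0 < K by rewrite /K; lra.
have KK : 0 < 2 * K * (K + eta) by rewrite !mulr_gt0//; lra.
(* With [w = c * (1 + r)], a wave forces [eta * J <= 2 * w^2 * K * (K + eta)]. The bound [1] gives
   [w^2 <= w]; the quotient then contradicts this. *)
pose mu0 := Num.min 1 (eta * J / (2 * K * (K + eta))).
have mu00 : 0 < mu0 by rewrite lt_min ltr01 divr_gt0// mulr_gt0.
(* Dividing by [1 + r] rather than [r] keeps the threshold positive at [r = 0] without changing the
   limit. *)
exists (fun r => mu0 / (1 + r)), mu0 => //; split.
- move=> r r0; have r1 : 0 < 1 + r by lra.
  split; first by rewrite divr_gt0.
  move=> c /andP[c0]; rewrite ltr_pdivlMr// => cmu phi wave.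
  have := wave_speed_bound m1 D0 std c0 r0 wave eta0 eta_le.
  rewrite -/J; set Gam := c * kappa + c * r * d kappa.
  pose w := c * (1 + r).
  have w0 : 0 < w by rewrite mulr_gt0.
  have cr0 : 0 <= c * r by rewrite mulr_ge0// ltW.
  have crw : c * r <= w by rewrite /w mulrDr; lra.
  have Gw : Gam <= w * K.
    have h1 : 0 <= c * r * kappa by rewrite mulr_ge0// ltW.
    have h2 : 0 <= c * d kappa by rewrite mulr_ge0// ltW.
    rewrite (_ : w * K = Gam + c * r * kappa + c * d kappa); last by rewrite /w /K /Gam; ring.
    lra.
  have G0 : 0 <= Gam by rewrite /Gam addr_ge0 ?mulr_ge0// ltW.
  have w1 : w < 1 by apply: lt_le_trans cmu _; rewrite ge_min lexx.
  have wJ : w * (2 * K * (K + eta)) < eta * J.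
    by rewrite -ltr_pdivlMr//; apply: lt_le_trans cmu _; rewrite ge_min lexx orbT.
  apply/negP; rewrite -ltNge; apply: le_lt_trans wJ.
  have h1 : Gam + eta * (c * r) <= w * (K + eta).
    have : eta * (c * r) <= eta * w by rewrite ler_wpM2l// ltW.
    lra.
  have h2 : Gam * (Gam + eta * (c * r)) <= (w * K) * (w * (K + eta)).
    apply: ler_pM => //; rewrite addr_ge0// mulr_ge0// ltW//.
  have h3 : w * (w * (K * (K + eta))) <= 1 * (w * (K * (K + eta))).
    rewrite ler_wpM2r ?(ltW w1)// !mulr_ge0 ?(ltW w0) ?(ltW K0)//; lra.
  lra.
- apply/cvgrPdist_lt => e e0; near=> r.
  have rgt : mu0 / e < r by near: r; apply: nbhs_pinfty_gt; rewrite num_real.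
  have r0 : 0 < r by apply: lt_trans rgt; rewrite divr_gt0.
  have -> : mu0 - r * (mu0 / (1 + r)) = mu0 / (1 + r) by field; rewrite gt_eqF//; lra.
  rewrite gtr0_norm ?divr_gt0 ?ltr_pdivrMr; [|lra..].
  by move: rgt; rewrite ltr_pdivrMr// => ?; lra.
Unshelve. all: by end_near. Qed.
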